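(* Let $p\in\mathbb{N}$, $p>1$, and let $f(z)=\sin(1/z^{p-1})$ for $z\in\mathbb{C}\setminus\{0\}$. Then for any $c>1$ there exist $\gamma>0$ and $\eta>0$ such that for any $\alpha\in[-\eta,\eta]$ and $\beta\in(\alpha,1]$ $$\varrho(\alpha,\beta)\not\subset\mathcal D^p_\gamma\ \Longrightarrow\ f\text{ is not analytic on }\varrho(\alpha,\beta)\ \text{ or }\ \sup_{z\in\varrho(\alpha,\beta)}|f(z)|>c\sup_{x\in[-1,1]}|f(x)|.$$
   Context: $\mathcal D^p_\gamma=\{x+iy: |y|\leqslant\gamma|x|^p\}$ for $\gamma>0$. For a fixed $A>1$ and $B=\sqrt{A^2-1}$, and real $\alpha<\beta$, $\varrho(\alpha,\beta)=\{x+iy: |x-\frac{\alpha+\beta}{2}|\leqslant A\frac{\beta-\alpha}{2},\ |y|\leqslant B\frac{\beta-\alpha}{2}\}$. Suprema of $|f|$ are taken over points of the indicated set lying in the domain $\mathbb{C}\setminus\{0\}$ of $f$; $f$ is not analytic on a set containing $0$. *)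

(* Defs.v *)
From Stdlib Require Export Reals.
From Coquelicot Require Export Coquelicot.
Open Scope R_scope.

Definition region (p : nat) (gamma : R) (z : C) : Prop :=
  Rabs (Im z) <= gamma * Rabs (Re z) ^ p.

Definition rect (A alpha beta : R) (z : C) : Prop :=
  let B := sqrt (A ^ 2 - 1) in
  Rabs (Re z - (alpha + beta) / 2) <= A * ((beta - alpha) / 2) /\
  Rabs (Im z) <= B * ((beta - alpha) / 2).

Definition real_segment (a b : R) (z : C) : Prop :=
  exists x : R, a <= x <= b /\ z = RtoC x.

Definition Cexp (z : C) : C :=
  (exp (Re z) * cos (Im z), exp (Re z) * sin (Im z)).

Definition Csin (z : C) : C :=
  ((Cexp (Ci * z) - Cexp (- (Ci * z))) / (2 * Ci))%C.

(* A function on a domain is encoded as a total function [f : C -> C] together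
   with a predicate [dom]; the values of [f] off [dom] are never used. *)

Definition analytic_at (dom : C -> Prop) (f : C -> C) (z0 : C) : Prop :=
  exists (r : posreal) (a : nat -> C),
    forall z : C, Cmod (z - z0)%C < r ->
      dom z /\
      is_pseries (K := C_AbsRing) (V := C_NormedModule) a (z - z0)%C (f z).

(* In particular [f] is not analytic on a set that is not included in [dom]. *)
Definition analytic_on (dom : C -> Prop) (f : C -> C) (S : C -> Prop) : Prop :=
  forall z : C, S z -> analytic_at dom f z.

(* The supremum, possibly infinite, of [|f|] over the points of [S] in [dom]. *)
Definition sup_Cmod (dom : C -> Prop) (f : C -> C) (S : C -> Prop) : Rbar :=
  Lub_Rbar (fun r : R => exists z : C, S z /\ dom z /\ r = Cmod (f z)).

Definition punctured_plane (z : C) : Prop := z <> RtoC 0.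

Definition sin_inv_pow (p : nat) (z : C) : C := Csin (1 / z ^ (p - 1))%C.

(* Main.v *)
Require Import Defs.
From Stdlib Require Import Reals Lra Lia.
From Coquelicot Require Import Coquelicot.
Open Scope R_scope.

(** If the rectangle contains [0], [f] is not analytic on it.  Otherwise the
    rectangle, being symmetric about the real axis, lies strictly on one side
    of the imaginary axis; let [x0] be the real abscissa of its nearest
    vertical edge.  That edge is closer to [0] than [alpha], so
    [0 < |x0| <= eta].  Write [n = p - 1] and let [z] be the point of the
    vertical line through [x0] at height [gamma |x0|^n x0], where the boundary
    curve of the region meets it.  A rectangle of smaller height than that
    would be contained in the region, because [|Re|] is smallest on that edge;
    hence [z] lies in the rectangle.

    Now [z = x0 (1 + i s)] with slope [s = gamma |x0|^n <= gamma eta], which is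
    small because [p > 1].  To first order, [Im (1 / z^n)] is
    [- n s / x0^n], of modulus [n gamma]: the blow-up of [1 / x0^n] cancels
    exactly against the vanishing of [s].  The rigorous form with a worse
    constant is [Im_inv_pow_lower], and it rests on the elementary control of
    [(1 + i s)^n] in [pow_one_plus_is_bounds].  Since [|sin]| grows with the
    imaginary part of its argument ([Cmod_Csin_lower]), a large [gamma] makes
    [|f z|] exceed [c], whereas [|f| <= 1] on the real axis. *)

(** * The complex sine *)

Lemma Cmod_Cexp (z : C) : Cmod (Cexp z) = exp (Re z).
Proof.
  unfold Cmod, Cexp; simpl.
  replace (_ + _) with
    (exp (Re z) ^ 2 * (Rsqr (sin (Im z)) + Rsqr (cos (Im z))))
    by (unfold Rsqr; ring).
  rewrite sin2_cos2, Rmult_1_r, sqrt_pow2; [reflexivity|].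
  left; apply exp_pos.
Qed.

(** [|sin w|] is at least [sinh |Im w|], by the reverse triangle inequality
    applied to the two exponentials; the linear bound follows from
    [1 + v <= exp v]. *)
Lemma Cmod_Csin_lower (w : C) : Rabs (Im w) / 2 <= Cmod (Csin w).
Proof.
  unfold Csin.
  assert (h2i : (2 * Ci)%C <> 0%C).
  { intros h; apply (f_equal snd) in h; simpl in h; lra. }
  rewrite Cmod_div by exact h2i.
  replace (Cmod (2 * Ci)) with 2.
  2:{ rewrite Cmod_mult, Cmod_R, Rabs_pos_eq by lra.
      unfold Cmod, Ci; simpl.
      replace (0 * (0 * 1) + 1 * (1 * 1)) with 1 by ring.
      rewrite sqrt_1; ring. }
  apply Rmult_le_compat_r; [lra|].
  set (a := Cexp (Ci * w)%C); set (b := Cexp (- (Ci * w))%C).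
  assert (ha : Cmod a = exp (- Im w)).
  { unfold a; rewrite Cmod_Cexp; f_equal; destruct w; simpl; ring. }
  assert (hb : Cmod b = exp (Im w)).
  { unfold b; rewrite Cmod_Cexp; f_equal; destruct w; simpl; ring. }
  assert (h1 : Cmod a <= Cmod (a - b) + Cmod b).
  { replace a with ((a - b) + b)%C at 1 by ring. apply Cmod_triangle. }
  assert (h2 : Cmod b <= Cmod (a - b) + Cmod a).
  { replace b with (- (a - b) + a)%C at 1 by ring.
    rewrite <- (Cmod_opp (a - b)). apply Cmod_triangle. }
  rewrite ha, hb in h1, h2.
  pose proof (exp_ineq1_le (Im w)) as e1.
  pose proof (exp_ineq1_le (- Im w)) as e2.
  destruct (Rle_lt_dec 0 (Im w)) as [h|h].
  - assert (exp (- Im w) <= 1).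
    { rewrite <- exp_0; destruct (Req_dec (Im w) 0) as [->|hne].
      - rewrite Ropp_0; lra.
      - left; apply exp_increasing; lra. }
    rewrite Rabs_pos_eq by lra; lra.
  - assert (exp (Im w) <= 1).
    { rewrite <- exp_0; left; apply exp_increasing; lra. }
    rewrite Rabs_left by lra; lra.
Qed.

Lemma Csin_RtoC (u : R) : Csin (RtoC u) = RtoC (sin u).
Proof.
  unfold Csin, Cexp; simpl.
  replace (0 * u - 1 * 0) with 0 by ring.
  replace (0 * 0 + 1 * u) with u by ring.
  rewrite Ropp_0, exp_0, cos_neg, sin_neg.
  apply injective_projections; simpl; field.
Qed.

Lemma RtoC_inv_pow (x : R) (n : nat) :
  x <> 0 -> (1 / RtoC x ^ n)%C = RtoC (1 / x ^ n).
Proof.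
  intros hx.
  now rewrite <- RtoC_pow, RtoC_div by now apply pow_nonzero.
Qed.

(** * Powers of a complex number of small slope *)

(** With [(1 + i s)^k = a + i b] the recurrence is [a' = a - s b] and
    [b' = b + s a].  As long as [k s] is small, [a] stays in [[1/2, 1]], so
    that [b] increases by between [s / 2] and [s] at each step. *)
Lemma pow_one_plus_is_bounds (s : R) (n : nat) :
  0 <= s -> INR n * s <= 1 / 2 ->
  1 - (INR n * s) ^ 2 <= Re ((1, s) ^ n)%C <= 1 /\
  INR n * s / 2 <= Im ((1, s) ^ n)%C <= INR n * s.
Proof.
  intros hs; induction n as [|n IH]; intros hn.
  - simpl; lra.
  - rewrite S_INR in *.
    pose proof (pos_INR n) as hpos.
    destruct IH as [[a1 a2] [b1 b2]]; [nra|].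
    change (((1, s) ^ S n)%C) with ((1, s) * (1, s) ^ n)%C.
    set (w := ((1, s) ^ n)%C) in *.
    assert (hre : Re ((1, s) * w)%C = Re w - s * Im w)
      by (destruct w; simpl; ring).
    assert (him : Im ((1, s) * w)%C = Im w + s * Re w)
      by (destruct w; simpl; ring).
    rewrite hre, him.
    set (a := Re w) in *; set (b := Im w) in *; set (N := INR n) in *.
    assert (0 <= N * s) by nra.
    assert (1 / 2 <= a) by nra.
    repeat split; nra.
Qed.

(** Writing [(1 + i s)^n = a + i b], the quantity is
    [b / (|x|^n (a^2 + b^2))] with [b >= n s / 2] and [a^2 + b^2 <= 2]. *)
Lemma Im_inv_pow_lower (x s : R) (n : nat) :
  x <> 0 -> 0 <= s -> INR n * s <= 1 / 2 ->
  INR n * s / 4 <= Rabs x ^ n * Rabs (Im (1 / (x, (x * s)%R) ^ n)%C).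
Proof.
  intros hx hs hn.
  destruct (pow_one_plus_is_bounds s n hs hn) as [[a1 a2] [b1 b2]].
  replace ((x, x * s) : C) with (RtoC x * (1, s))%C
    by (apply injective_projections; simpl; ring).
  rewrite Cpow_mult_l, <- RtoC_pow.
  destruct ((1, s) ^ n)%C as [a b]; simpl in a1, a2, b1, b2.
  pose proof (pos_INR n) as hpos.
  assert (hns : 0 <= INR n * s) by now apply Rmult_le_pos.
  assert (ha : 3 / 4 <= a) by nra.
  assert (hd : 0 < a ^ 2 + b ^ 2) by nra.
  assert (hd2 : a ^ 2 + b ^ 2 <= 2) by nra.
  assert (hX : x ^ n <> 0) by now apply pow_nonzero.
  replace (Im (1 / (RtoC (x ^ n) * (a, b)))%C)
    with (- (b / (a ^ 2 + b ^ 2)) * / x ^ n).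
  2:{ simpl; field; repeat split; [|exact hX|nra].
      replace (_ + _) with ((x ^ n) ^ 2 * (a ^ 2 + b ^ 2)) by ring.
      apply Rmult_integral_contrapositive_currified; [|lra].
      now apply pow_nonzero. }
  rewrite Rabs_mult, Rabs_Ropp, Rabs_inv, RPow_abs.
  replace (Rabs (x ^ n) * (Rabs (b / (a ^ 2 + b ^ 2)) * / Rabs (x ^ n)))
    with (Rabs (b / (a ^ 2 + b ^ 2)))
    by (field; now apply Rabs_no_R0).
  rewrite (Rabs_pos_eq (b / _)) by (apply Rdiv_le_0_compat; lra).
  apply Rmult_le_reg_r with (a ^ 2 + b ^ 2); [exact hd|].
  replace (b / (a ^ 2 + b ^ 2) * (a ^ 2 + b ^ 2)) with b by (field; nra).
  apply Rle_trans with (INR n * s / 4 * 2); [|lra].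
  apply Rmult_le_compat_l; lra.
Qed.

(** * Suprema and the rectangle *)

Lemma sup_Cmod_real_segment_le_1 (p : nat) (a b : R) :
  Rbar_le (sup_Cmod punctured_plane (sin_inv_pow p) (real_segment a b)) 1.
Proof.
  apply Lub_Rbar_correct.
  intros r [z [[x [_ ->]] [hz ->]]]; simpl.
  unfold sin_inv_pow.
  rewrite RtoC_inv_pow by (intros h; apply hz; now rewrite h).
  rewrite Csin_RtoC, Cmod_R.
  apply Rabs_le, SIN_bound.
Qed.

Lemma le_sup_Cmod (dom : C -> Prop) (f : C -> C) (S : C -> Prop) (z : C) :
  S z -> dom z -> Rbar_le (Cmod (f z)) (sup_Cmod dom f S).
Proof.
  intros hS hd; apply Lub_Rbar_correct; now exists z.
Qed.

Lemma Rbar_mult_le_of_le_1 (c : R) (l : Rbar) :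
  0 < c -> Rbar_le l 1 -> Rbar_le (Rbar_mult c l) c.
Proof.
  intros hc; destruct l as [l| |]; simpl; intros hl.
  - nra.
  - contradiction.
  - destruct (Rle_dec 0 c) as [h|h]; [|lra].
    destruct (Rle_lt_or_eq_dec 0 c h); simpl; [exact I | lra].
Qed.

Lemma not_analytic_on_of_mem (dom : C -> Prop) (f : C -> C) (S : C -> Prop)
  (z : C) : S z -> ~ dom z -> ~ analytic_on dom f S.
Proof.
  intros hS hd h; destruct (h z hS) as [r [a hr]].
  apply hd, (hr z).
  replace (z - z)%C with (RtoC 0) by ring.
  rewrite Cmod_0; apply cond_pos.
Qed.

(** Here [m] is the centre, [h] the half-length before dilation and [A h] the
    half-length after it; [x0] is the endpoint nearest to [0], and the
    undilated endpoint [m - h] is further from [0] than [x0] whichever side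
    the interval lies on. *)
Lemma nearest_endpoint (A m h : R) :
  1 < A -> 0 < h -> A * h < Rabs m ->
  exists x0 : R, x0 <> 0 /\ Rabs (x0 - m) <= A * h /\
    Rabs x0 <= Rabs (m - h) /\
    forall x : R, Rabs (x - m) <= A * h -> Rabs x0 <= Rabs x.
Proof.
  intros hA hh hm.
  assert (hAh : h < A * h) by nra.
  destruct (Rle_lt_dec 0 m) as [h0|h0].
  - rewrite Rabs_pos_eq in hm by lra.
    exists (m - A * h); repeat split.
    + lra.
    + apply Rabs_le; lra.
    + rewrite !Rabs_pos_eq; lra.
    + intros x hx; apply Rabs_le_between in hx.
      rewrite !Rabs_pos_eq; lra.
  - rewrite Rabs_left in hm by lra.
    exists (m + A * h); repeat split.
    + lra.
    + apply Rabs_le; lra.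
    + rewrite !Rabs_left; lra.
    + intros x hx; apply Rabs_le_between in hx.
      rewrite !Rabs_left; lra.
Qed.

Theorem theorem25 :
  forall (A : R) (hA : 1 < A) (p : nat) (hp : (1 < p)%nat) (c : R) (hc : 1 < c),
  exists gamma : R, exists eta : R, 0 < gamma /\ 0 < eta /\
    forall alpha beta : R,
      - eta <= alpha <= eta -> alpha < beta <= 1 ->
      ~ (forall z : C, rect A alpha beta z -> region p gamma z) ->
      ~ analytic_on punctured_plane (sin_inv_pow p) (rect A alpha beta) \/
      Rbar_lt
        (Rbar_mult (Finite c)
           (sup_Cmod punctured_plane (sin_inv_pow p) (real_segment (-1) 1)))
        (sup_Cmod punctured_plane (sin_inv_pow p) (rect A alpha beta)).
Proof.
  intros A hA p hp c hc.
  destruct p as [|n]; [lia|].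
  assert (hn1 : 1 <= INR n) by (apply (le_INR 1); lia).
  (* The argument loses a factor 4 in the imaginary part and a factor 2 in the
     sine, so any [gamma > 8 c] is large enough; [eta] is then such that
     [n gamma eta <= 1 / 2]. *)
  exists (16 * c), (/ (32 * c * INR n)).
  set (g := 16 * c).
  assert (hcn : 0 < 32 * c * INR n) by nra.
  set (eta := / (32 * c * INR n)).
  assert (heta : 0 < eta) by now apply Rinv_0_lt_compat.
  assert (hge : INR n * (g * eta) = 1 / 2) by (unfold g, eta; field; nra).
  assert (heta1 : eta <= 1) by (unfold g in *; nra).
  split; [unfold g; lra | split; [exact heta|]].
  intros alpha beta halpha hbeta hnot.
  set (m := (alpha + beta) / 2); set (h := (beta - alpha) / 2).
  assert (hh : 0 < h) by (unfold h; lra).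
  assert (hB : 0 <= sqrt (A ^ 2 - 1) * h)
    by (apply Rmult_le_pos; [apply sqrt_pos | lra]).
  destruct (Rle_lt_dec (Rabs m) (A * h)) as [hm|hm].
  { left; apply not_analytic_on_of_mem with (RtoC 0).
    - split; simpl; fold m h.
      + now rewrite Rminus_0_l, Rabs_Ropp.
      + now rewrite Rabs_R0.
    - intros hz; now apply hz. }
  right.
  destruct (nearest_endpoint A m h hA hh hm) as [x0 [hx0 [hmem [hsmall hmin]]]].
  replace (m - h) with alpha in hsmall by (unfold m, h; field).
  assert (hax : Rabs x0 <= eta)
    by (apply Rle_trans with (1 := hsmall), Rabs_le, halpha).
  assert (hpos : 0 < Rabs x0) by now apply Rabs_pos_lt.
  set (s := g * Rabs x0 ^ n).
  assert (hpow : 0 < Rabs x0 ^ n) by now apply pow_lt.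
  assert (hs : 0 < s) by (unfold s, g; nra).
  assert (hns : INR n * s <= 1 / 2).
  { rewrite <- hge; apply Rmult_le_compat_l; [lra|].
    apply Rmult_le_compat_l; [unfold g; lra|].
    apply Rle_trans with (2 := hax).
    (* [|x0|^n <= |x0|] as [n >= 1]: for [p = 1] the slope would be [gamma],
       however small [x0] is. *)
    destruct n as [|k]; [lia|]; simpl.
    apply Rle_trans with (Rabs x0 * 1); [|lra].
    apply Rmult_le_compat_l; [lra|].
    rewrite <- (pow1 k); apply pow_incr; lra. }
  set (z := (x0, x0 * s) : C).
  assert (hz : rect A alpha beta z).
  { split; simpl; fold m h; [exact hmem|].
    destruct (Rle_lt_dec (Rabs (x0 * s)) (sqrt (A ^ 2 - 1) * h)) as [hle|hlt].
    { exact hle. }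
    exfalso; apply hnot; intros w [hw1 hw2]; fold m h in hw1, hw2.
    unfold region.
    apply Rle_trans with (1 := hw2), Rlt_le, Rlt_le_trans with (1 := hlt).
    rewrite Rabs_mult, (Rabs_pos_eq s) by lra.
    replace (Rabs x0 * s) with (g * Rabs x0 ^ S n) by (unfold s; simpl; ring).
    apply Rmult_le_compat_l; [unfold g; lra|].
    apply pow_incr; split; [lra | now apply hmin]. }
  assert (hz0 : punctured_plane z).
  { intros e; apply hx0; exact (f_equal fst e). }
  apply Rbar_le_lt_trans with (Finite c).
  { apply Rbar_mult_le_of_le_1; [lra | apply sup_Cmod_real_segment_le_1]. }
  apply Rbar_lt_le_trans with (Finite (Cmod (sin_inv_pow (S n) z))).
  2: now apply le_sup_Cmod.
  simpl; unfold sin_inv_pow.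
  replace (S n - 1)%nat with n by lia.
  apply Rlt_le_trans with (2 := Cmod_Csin_lower _).
  pose proof (Im_inv_pow_lower x0 s n hx0 (Rlt_le _ _ hs) hns) as hi.
  fold z in hi.
  set (v := Rabs (Im (1 / z ^ n)%C)) in *.
  assert (hv : g / 4 <= v).
  { apply Rmult_le_reg_l with (1 := hpow).
    apply Rle_trans with (2 := hi).
    replace (Rabs x0 ^ n * (g / 4)) with (s / 4) by (unfold s; field).
    nra. }
  unfold g in hv; lra.
Qed.
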